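(* Let $M$ be a smooth Poisson manifold with Poisson bivector $\pi$, $\mathcal A=C^\infty(M)$ with Poisson bracket $\{\cdot,\cdot\}$, and let $\mathcal C\subseteq\mathcal A$ be a subalgebra with $\{f,g\}=0$ for all $f,g\in\mathcal C$. Let $\ast$ be a star-product on $\mathcal A[[\hbar]]$, let $n\ge2$, and let $\ast_n$ be a star-product equivalent to $\ast$, $$a\ast_n b=ab+\sum_{k\ge1}\hbar^kB_k(a,b),$$ such that $B_1(a,b)=B_2(a,b)=\dots=B_n(a,b)=0$ for all $a,b\in\mathcal C$. Then: (1) the restriction $B_{n+1}:\mathcal C\otimes\mathcal C\to\mathcal A$ is a Hochschild cocycle; (2) if the class of $B_{n+1}$ in $H^2(\mathcal C,\mathcal A)$ lies in the image of $[\pi,\cdot]:H^1(\mathcal C,\mathcal A)\to H^2(\mathcal C,\mathcal A)$, then $\ast_n$ can be deformed to $\ast_{n+1}$, i.e. there exists a star-product $\ast_{n+1}$ equivalent to $\ast_n$ whose coefficients of $\hbar,\hbar^2,\dots,\hbar^{n+1}$ all vanish on $\mathcal C\otimes\mathcal C$.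
   Context: Local cochains: $CH^n(\mathcal A)$ is the space of $n$-linear maps $\varphi:\mathcal A^{\otimes n}\to\mathcal A$ that are local on $M$: $\varphi(f_1,\dots,f_n)(x)=\varphi(g_1,\dots,g_n)(x)$ whenever $f_i=g_i$ on some open neighbourhood of $x$ for all $i$ (equivalently, $\varphi$ is given by a polydifferential operator on $M$). $CH^n(\mathcal C,\mathcal A)$ is the space of $n$-linear maps $\mathcal C^{\otimes n}\to\mathcal A$ that are local on $M$, meaning that they are restrictions to $\mathcal C$ of elements of $CH^n(\mathcal A)$. Both carry the Hochschild differential $$d\varphi(f_1,\dots,f_{i+1})=f_1\varphi(f_2,\dots,f_{i+1})+\sum_{j=1}^i(-1)^j\varphi(f_1,\dots,f_jf_{j+1},\dots,f_{i+1})+(-1)^{i+1}\varphi(f_1,\dots,f_i)f_{i+1},$$ and $H^*(\mathcal C,\mathcal A)$ denotes the cohomology of $CH^*(\mathcal C,\mathcal A)$. Action of $\pi$: for a 1-cocycle $\xi:\mathcal C\to\mathcal A$ (a derivation of $\mathcal C$ with values in $\mathcal A$), $[\pi,\xi](a,b)=\{\xi(a),b\}+\{a,\xi(b)\}$ for $a,b\in\mathcal C$. This induces the map $[\pi,\cdot]:H^1(\mathcal C,\mathcal A)\to H^2(\mathcal C,\mathcal A)$. Star-product: an $\hbar$-linear ($\hbar$-adically continuous) associative product $a\ast b=ab+\sum_{k\ge1}\hbar^kB_k(a,b)$ on $\mathcal A[[\hbar]]$ with all $B_k\in CH^2(\mathcal A)$; throughout it is assumed that $B_1=\{\cdot,\cdot\}$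 on $\mathcal A$. Equivalence: star-products $\ast_1,\ast_2$ are equivalent if there is a formal power series of differential operators $D=\mathrm{id}+\hbar D_1+\hbar^2D_2+\dots$, $D_k\in CH^1(\mathcal A)$, with $D(a\ast_2b)=D(a)\ast_1D(b)$. *)

(* Defs.v *)
From HB Require Import structures.
From mathcomp Require Import all_boot all_order all_algebra.
From mathcomp Require Import all_classical all_reals all_analysis.

Set Implicit Arguments.
Unset Strict Implicit.
Unset Printing Implicit Defensive.

Import Order.TTheory GRing.Theory Num.Theory numFieldNormedType.Exports.

Local Open Scope classical_set_scope.
Local Open Scope ring_scope.

Section SmoothOn.
Variables (R : realType) (d : nat).
Implicit Types (U : set 'rV[R]_d) (f g : 'rV[R]_d -> R).

Definition partial (i : 'I_d) f : 'rV[R]_d -> R := 'D_(delta_mx 0 i) f.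

(* Meant for open U: everything below only depends on the germs of f at the
   points of U. *)
Fixpoint Ck_on (k : nat) U f : Prop :=
  match k with
  | 0 => forall y, U y -> {for y, continuous f}
  | k'.+1 => [/\ forall y, U y -> {for y, continuous f},
                 forall i y, U y -> derivable f y (delta_mx 0 i) &
                 forall i, Ck_on k' U (partial i f)]
  end.

Definition smooth_on U f : Prop := forall k, Ck_on k U f.

Lemma Ck_on0 k U f : Ck_on k U f -> forall y, U y -> {for y, continuous f}.
Proof. by case: k => [//|k []]. Qed.

Lemma Ck_onS k U f : Ck_on k.+1 U f -> Ck_on k U f.
Proof.
elim: k f => [f [] //|k IH f [cf df Df]].
by split=> // i; apply/IH/Df.
Qed.

Lemma Ck_on_ext k U f g : open U -> (forall y, U y -> f y = g y) ->
  Ck_on k U f -> Ck_on k U g.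
Proof.
move=> oU; have near_ext (h h' : 'rV[R]_d -> R) y : U y ->
    (forall y, U y -> h y = h' y) -> {near y, h =1 h'}.
  by move=> Uy e; apply: filterS (open_nbhs_nbhs (conj oU Uy)) => z /e.
have cont (h h' : 'rV[R]_d -> R) : (forall y, U y -> h y = h' y) ->
    (forall y, U y -> {for y, continuous h}) ->
    forall y, U y -> {for y, continuous h'}.
  move=> e ch y Uy; rewrite /prop_for /continuous_at -(e y Uy).
  by apply: cvg_trans (ch y Uy); exact: (@near_eq_cvg _ _ (nbhs y) _ h h' (near_ext _ _ _ Uy e)).
elim: k f g => [f g e|k IH f g e [cf df Df]]; first exact: cont.
split; first exact: cont cf.
- by move=> i y Uy; apply: near_eq_derivable (df i y Uy); exact: near_ext _ _ _ Uy e.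
- move=> i; apply: IH (Df i) => y Uy.
  by apply: near_eq_derive; exact: near_ext _ _ _ Uy e.
Qed.

Lemma Ck_on_cst k U (c : R) : open U -> Ck_on k U (cst c).
Proof.
move=> oU; elim: k c => [|k IH] c /=; first by move=> y _; exact: cst_continuous.
split; first by move=> y _; exact: cst_continuous.
  by move=> i y _; exact: derivable_cst.
move=> i; apply: (@Ck_on_ext _ _ (cst 0)) => // y _.
by rewrite /partial derive_cst.
Qed.

Lemma Ck_onD k U f g : open U -> Ck_on k U f -> Ck_on k U g ->
  Ck_on k U (f + g).
Proof.
move=> oU; elim: k f g => [f g cf cg y Uy|k IH f g [cf df Df] [cg dg Dg]].
  exact: continuousD (cf y Uy) (cg y Uy).
split=> [y Uy|i y Uy|i].
- exact: continuousD (cf y Uy) (cg y Uy).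
- by apply: derivableD; [exact: df | exact: dg].
- apply: Ck_on_ext (IH _ _ (Df i) (Dg i)) => // y Uy.
  by rewrite /partial deriveD; [|exact: df|exact: dg].
Qed.

Lemma Ck_onM k U f g : open U -> Ck_on k U f -> Ck_on k U g ->
  Ck_on k U (f * g).
Proof.
move=> oU; elim: k f g => [f g cf cg y Uy|k IH f g Cf Cg].
  exact: continuousM (cf y Uy) (cg y Uy).
have [[cf df Df] [cg dg Dg]] := (Cf, Cg).
split=> [y Uy|i y Uy|i].
- exact: continuousM (cf y Uy) (cg y Uy).
- by apply: derivableM; [exact: df | exact: dg].
- have := Ck_onD oU (IH _ _ (Ck_onS Cf) (Dg i)) (IH _ _ (Ck_onS Cg) (Df i)).
  apply: Ck_on_ext => // y Uy.
  by rewrite /partial deriveM; [|exact: df|exact: dg].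
Qed.

End SmoothOn.

Record chart (R : realType) (d : nat) (M : topologicalType) := Chart {
  cdom : set M;
  ccod : set 'rV[R]_d;
  cmap :> M -> 'rV[R]_d;
  cinv : 'rV[R]_d -> M;
  cdom_open : open cdom;
  ccod_open : open ccod;
  cmap_cod : forall x, cdom x -> ccod (cmap x);
  cinv_dom : forall y, ccod y -> cdom (cinv y);
  cmapK : forall x, cdom x -> cinv (cmap x) = x;
  cinvK : forall y, ccod y -> cmap (cinv y) = y;
  cmap_continuous : forall x, cdom x -> {for x, continuous cmap};
  cinv_continuous : forall y, ccod y -> {for y, continuous cinv} }.

Definition transition (R : realType) (d : nat) (M : topologicalType)
  (c c' : chart R d M) : 'rV[R]_d -> 'rV[R]_d := c' \o cinv c.

Record smooth_manifold (R : realType) (d : nat) := SmoothManifold {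
  mcarrier :> topologicalType;
  atlas : set (chart R d mcarrier);
  manifold_hausdorff : hausdorff_space mcarrier;
  manifold_second_countable : @second_countable mcarrier;
  atlas_cover : forall x : mcarrier, exists2 c, atlas c & cdom c x;
  atlas_smooth : forall c c', atlas c -> atlas c' -> forall i,
    smooth_on (ccod c `&` cinv c @^-1` cdom c')
      (fun y => transition c c' y 0 i) }.

Section SmoothFunctions.
Variables (R : realType) (d : nat) (M : smooth_manifold R d).

Definition smooth (f : M -> R) : Prop :=
  forall c, atlas c -> smooth_on (ccod c) (f \o cinv c).

Definition smooth_pred : pred (M -> R) := fun f => `[< smooth f >].

Lemma smooth_subring_closed : subring_closed smooth_pred.
Proof.
have smooth_cst a : smooth (cst a).
  by move=> c _ k; apply: Ck_on_cst; exact: ccod_open.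
have smoothM f g : smooth f -> smooth g -> smooth (f * g).
  move=> sf sg c Ac k; rewrite (_ : _ \o _ = (f \o cinv c) * (g \o cinv c)) //.
  by apply: Ck_onM; [exact: ccod_open|exact: sf|exact: sg].
have smoothD f g : smooth f -> smooth g -> smooth (f + g).
  move=> sf sg c Ac k; rewrite (_ : _ \o _ = (f \o cinv c) + (g \o cinv c)) //.
  by apply: Ck_onD; [exact: ccod_open|exact: sf|exact: sg].
split=> [|f g /asboolP sf /asboolP sg|f g /asboolP sf /asboolP sg]; apply/asboolP.
- exact: smooth_cst.
- by rewrite -mulN1r; apply: smoothD => //; apply: smoothM => //; exact: (smooth_cst (-1)).
- exact: smoothM.
Qed.

HB.instance Definition _ :=
  GRing.isSubringClosed.Build (M -> R) smooth_pred smooth_subring_closed.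

Lemma smooth_scaler_closed : scaler_closed smooth_pred.
Proof.
move=> a f sf; suff -> : a *: f = cst a * f.
  apply: rpredM => //; apply/asboolP => c _ k.
  by apply: Ck_on_cst; exact: ccod_open.
by apply/funext.
Qed.

HB.instance Definition _ :=
  GRing.isScaleClosed.Build R (M -> R) smooth_pred smooth_scaler_closed.

Record smoothfun := SmoothFun {
  smoothfun_fun :> M -> R;
  smoothfunP : smoothfun_fun \in smooth_pred }.

HB.instance Definition _ := [isSub for smoothfun_fun].
HB.instance Definition _ := [Choice of smoothfun by <:].
HB.instance Definition _ := GRing.SubChoice_isSubComPzRing.Build
  (M -> R) smooth_pred smoothfun smooth_subring_closed.
HB.instance Definition _ := [SubZmodule_isSubLmodule of smoothfun by <:].

End SmoothFunctions.

Section Poisson.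
Variables (R : realType) (d : nat) (M : smooth_manifold R d).

Definition chart_grad (c : chart R d M) (f : M -> R) (x : M) : 'rV[R]_d :=
  \row_i partial i (f \o cinv c) (c x).

(* A bivector field given by its components pi^{ij} in the charts of the
   atlas, pi = 1/2 \sum_(i, j) pi^{ij} d_i /\ d_j. The (i, j) entry of 'J f p is
   the i-th partial derivative of the j-th component of f. *)
Record bivector_field := BivectorField {
  bivector :> chart R d M -> M -> 'M[R]_d;
  bivector_alt : forall c x, atlas c -> cdom c x ->
    (bivector c x)^T = - bivector c x;
  bivector_smooth : forall c, atlas c -> forall i j,
    smooth_on (ccod c) (fun y => bivector c (cinv c y) i j);
  bivector_transition : forall c c' x, atlas c -> atlas c' ->
    cdom c x -> cdom c' x ->
    let J := 'J (transition c c') (c x) in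
    bivector c' x = J^T *m bivector c x *m J }.

(* bracketE is {f, g} = pi(df, dg); given it, the Jacobi identity is the
   vanishing of the Schouten bracket [pi, pi]. *)
Record poisson_structure := PoissonStructure {
  poisson_bivector : bivector_field;
  bracket : smoothfun M -> smoothfun M -> smoothfun M;
  bracketE : forall f g c x, atlas c -> cdom c x ->
    bracket f g x = (chart_grad c f x *m poisson_bivector c x
                       *m (chart_grad c g x)^T) 0 0;
  bracket_jacobi : forall f g h, bracket f (bracket g h)
    + bracket g (bracket h f) + bracket h (bracket f g) = 0 }.

End Poisson.

Section Cochains.
Variables (R : realType) (d : nat) (M : smooth_manifold R d).
Local Notation A := (smoothfun M).

Definition multilinear (n : nat) (phi : ('I_n -> A) -> A) : Prop :=
  forall i (f : 'I_n -> A) (a : R) (u v : A),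
    phi [eta f with i |-> a *: u + v] =
    a *: phi [eta f with i |-> u] + phi [eta f with i |-> v].

Definition local_cochain (n : nat) (phi : ('I_n -> A) -> A) : Prop :=
  forall (x : M) (f g : 'I_n -> A),
    (forall i, \forall y \near x, f i y = g i y) -> phi f x = phi g x.

Definition CH (n : nat) : set (('I_n -> A) -> A) :=
  [set phi | multilinear phi /\ local_cochain phi].

(* No unit is required, so that unital subalgebras are a special case. *)
Record subalgebra := Subalgebra {
  subalg_set :> set A;
  subalg0 : subalg_set 0;
  subalgD : forall a b, subalg_set a -> subalg_set b -> subalg_set (a + b);
  subalgZ : forall (k : R) a, subalg_set a -> subalg_set (k *: a);
  subalgM : forall a b, subalg_set a -> subalg_set b -> subalg_set (a * b) }.

Definition subalg_mul (C : subalgebra) (a b : C) : C :=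
  SigSub (mem_set (subalgM (set_valP a) (set_valP b))).

Variable C : subalgebra.

Definition restrict_cochain (n : nat) (phi : ('I_n -> A) -> A) :
  ('I_n -> C) -> A := fun f => phi (fun i => set_val (f i)).

Definition CHsub (n : nat) : set (('I_n -> C) -> A) :=
  @restrict_cochain n @` @CH n.

(* (f_0, ..., f_j f_(j+1), ..., f_n) *)
Definition merge_args (n : nat) (j : 'I_n) (f : 'I_n.+1 -> C) : 'I_n -> C :=
  fun i => let fi := f (widen_ord (leqnSn n) i) in
           let fSi := f (lift ord0 i) in
           if (i < j)%N then fi else if i == j then subalg_mul fi fSi else fSi.

Definition hochschild_d (n : nat) (phi : ('I_n -> C) -> A) :
    ('I_n.+1 -> C) -> A := fun f =>
  set_val (f ord0) * phi (fun i => f (lift ord0 i))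
  + \sum_(j < n) (-1) ^+ j.+1 * phi (merge_args j f)
  + (-1) ^+ n.+1 * (phi (fun i => f (widen_ord (leqnSn n) i))
                      * set_val (f ord_max)).

Definition cocycle (n : nat) : set (('I_n -> C) -> A) :=
  [set phi | CHsub phi /\ hochschild_d phi = 0].

Definition coboundary (n : nat) : set (('I_n -> C) -> A) :=
  match n with
  | 0 => [set 0]
  | m.+1 => @hochschild_d m @` @CHsub m
  end.

Definition hclass (n : nat) (phi : ('I_n -> C) -> A) : set (('I_n -> C) -> A) :=
  [set psi | cocycle psi /\ coboundary (psi - phi)].

(* H^n(C, A), its elements being cosets of cocycles modulo coboundaries. *)
Definition HH (n : nat) : set (set (('I_n -> C) -> A)) :=
  @hclass n @` @cocycle n.

Variable P : poisson_structure M.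

Definition pi_action (xi : ('I_1 -> C) -> A) : ('I_2 -> C) -> A := fun f =>
  let a := f ord0 in let b := f ord_max in
  bracket P (xi (fun=> a)) (set_val b) + bracket P (set_val a) (xi (fun=> b)).

Definition pi_action_H (X : set (('I_1 -> C) -> A)) : set (('I_2 -> C) -> A) :=
  \bigcup_(xi in X) hclass (pi_action xi).

End Cochains.

Section StarProducts.
Variables (R : realType) (d : nat) (M : smooth_manifold R d).
Local Notation A := (smoothfun M).

(* A[[hbar]]: a stands for \sum_k hbar^k a_k; only the pointwise linear
   structure of nat -> A is used. *)
Definition fps := nat -> A.

Definition fps_const (a : A) : fps := fun k => if k is 0 then a else 0.

Definition fps_hbar (a : fps) : fps := fun k => if k is k'.+1 then a k' else 0.

Definition fps_add (a b : fps) : fps := fun k => a k + b k.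

Definition fps_scale (c : R) (a : fps) : fps := fun k => c *: a k.

Definition fps_eqmod (N : nat) (a b : fps) : Prop :=
  forall k, (k < N)%N -> a k = b k.

Definition coef2 (op : fps -> fps -> fps) (k : nat) (a b : A) : A :=
  op (fps_const a) (fps_const b) k.

Definition cochain2 (B : A -> A -> A) : ('I_2 -> A) -> A :=
  fun f => B (f ord0) (f ord_max).

Record star_product (P : poisson_structure M) := StarProduct {
  star :> fps -> fps -> fps;
  star_linearl : forall c a a' b,
    star (fps_add (fps_scale c a) a') b =
    fps_add (fps_scale c (star a b)) (star a' b);
  star_linearr : forall c a b b',
    star a (fps_add (fps_scale c b) b') =
    fps_add (fps_scale c (star a b)) (star a b');
  star_hbarl : forall a b, star (fps_hbar a) b = fps_hbar (star a b);
  star_hbarr : forall a b, star a (fps_hbar b) = fps_hbar (star a b);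
  star_adic_continuous : forall a b N, exists K, forall a' b',
    fps_eqmod K a a' -> fps_eqmod K b b' ->
    fps_eqmod N (star a b) (star a' b');
  starA : associative star;
  star_coef0 : forall a b, coef2 star 0 a b = a * b;
  star_coef1 : forall a b, coef2 star 1 a b = bracket P a b;
  star_coef_local : forall k, (1 <= k)%N -> CH (cochain2 (coef2 star k)) }.

Definition formal_diffop (D : nat -> A -> A) : Prop :=
  D 0%N = id /\ forall k, (1 <= k)%N -> CH (fun f : 'I_1 -> A => D k (f ord0)).

Definition apply_fps (D : nat -> A -> A) (a : fps) : fps :=
  fun m => \sum_(i < m.+1) D i (a (m - i)%N).

Definition star_equiv (P : poisson_structure M) (s1 s2 : star_product P) :=
  exists2 D, formal_diffop D & forall a b : fps,
    apply_fps D (s2 a b) = s1 (apply_fps D a) (apply_fps D b).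

(* The coefficients of hbar, ..., hbar^n vanish on C (x) C. *)
Definition vanishes_upto (P : poisson_structure M) (C : subalgebra M)
    (s : star_product P) (n : nat) : Prop :=
  forall k, (1 <= k <= n)%N -> forall a b,
    subalg_set C a -> subalg_set C b -> coef2 s k a b = 0.

End StarProducts.

Arguments CH {R d M} n.
Arguments CHsub {R d M} C n.
Arguments cocycle {R d M} C n.
Arguments coboundary {R d M} C n.
Arguments HH {R d M} C n.
Arguments pi_action_H {R d M C} P.
Arguments restrict_cochain {R d M} C {n}.

(* Main.v *)
Require Import Defs.
From mathcomp Require Import all_boot all_order all_algebra.
From mathcomp Require Import all_classical all_reals all_analysis.
From mathcomp Require Import zify ring.

Set Implicit Arguments.
Unset Strict Implicit.
Unset Printing Implicit Defensive.

Import GRing.Theory.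

Local Open Scope classical_set_scope.
Local Open Scope ring_scope.

(** Part (1) is associativity read in degree n+1: for a, b, c in C every
    product of two coefficients of positive degree applied to them vanishes,
    because its inner factor is some B_i with 1 <= i <= n evaluated on C.
    What survives is the Hochschild cocycle identity ([first_coef_cocycle]).

    For part (2), the hypothesis gives on C an identity B_(n+1) =
    [pi, xi] + d eta, where the derivation xi and the 1-cochain eta are
    restrictions to C of local operators X and Y on the whole algebra.
    Conjugating the star-product by T = id - hbar^n X - hbar^(n+1) Y, that is,
    passing to T^-1 (T a * T b), changes its low coefficients as follows
    ([conj_coef2_low], [conj_coef2_m], [conj_coef2_mS]).
    - Below degree n nothing changes. As n >= 2, this includes degree 1, so
      that the new product still has the Poisson bracket there.
    - In degree n the change is minus the Hochschild differential of X, which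
      is zero on C because xi is a cocycle.
    - In degree n+1 the change is -[pi, xi] - d eta, plus the value of X at
      the bracket of two elements of C, which is zero. This kills B_(n+1).
    Only terms linear in X and Y occur in these degrees: a term with two of
    them has degree at least 2n, which exceeds n+1.

    It remains to see that conjugation by a formal differential operator T
    yields a star-product at all. T is unitriangular for the hbar-filtration,
    hence bijective, and the algebraic axioms follow by applying T to both
    sides. Continuity and locality follow from the same triangularity, since
    T not only preserves but also reflects congruence modulo hbar^N and
    equality of germs ([apply_fps_eqmod_inv], [apply_fps_germ_inv]):
    applied to T (a *' b) = T a * T b, this transfers them to a *' b. *)

(** * Germs and local cochains *)

Section Germs.
Variables (R : realType) (d : nat) (M : smooth_manifold R d).
Local Notation A := (smoothfun M).
Implicit Types (x : M) (u v : A).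

Definition same_germ x u v := \forall y \near x, u y = v y.

Lemma same_germ_refl x u : same_germ x u u.
Proof. by near=> y. Unshelve. all: by end_near. Qed.

Lemma same_germD x u u' v v' :
  same_germ x u u' -> same_germ x v v' -> same_germ x (u + v) (u' + v').
Proof. by apply: filterS2 => y /= eu ev; congr (_ + _). Qed.

Lemma same_germN x u u' : same_germ x u u' -> same_germ x (- u) (- u').
Proof. by apply: filterS => y /= eu; congr (- _). Qed.

Lemma same_germM x u u' v v' :
  same_germ x u u' -> same_germ x v v' -> same_germ x (u * v) (u' * v').
Proof. by apply: filterS2 => y /= eu ev; congr (_ * _). Qed.

Lemma same_germ_sum x n (F G : 'I_n -> A) :
  (forall i, same_germ x (F i) (G i)) ->
  same_germ x (\sum_(i < n) F i) (\sum_(i < n) G i).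
Proof.
move=> FG; apply: (big_ind2 (same_germ x)) => //; first exact: same_germ_refl.
by move=> *; exact: same_germD.
Qed.

(** Locality is a statement about values at one point; this is its consequence
    for germs, which is what makes local maps composable. *)
Lemma local_cochain_germ n (phi : ('I_n -> A) -> A) x (f g : 'I_n -> A) :
  local_cochain phi -> (forall i, same_germ x (f i) (g i)) ->
  same_germ x (phi f) (phi g).
Proof.
move=> lphi fg.
have: \forall y \near x, forall i, \forall z \near y, f i z = g i z.
  by apply: filter_forall => i; exact: near_join (fg i).
by apply: filterS => y; exact: lphi.
Qed.

Lemma CH1_linear (D : A -> A) a u v :
  CH 1 (fun f : 'I_1 -> A => D (f ord0)) -> D (a *: u + v) = a *: D u + D v.
Proof. by case=> /(_ ord0 (fun=> 0) a u v). Qed.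

Lemma CH1_0 (D : A -> A) : CH 1 (fun f : 'I_1 -> A => D (f ord0)) -> D 0 = 0.
Proof.
move=> /(CH1_linear 1 0 0); rewrite !scale1r addr0 => /(congr1 (+%R^~ (- D 0))).
by rewrite addrK subrr.
Qed.

Lemma CH1_germ (D : A -> A) x u v :
  CH 1 (fun f : 'I_1 -> A => D (f ord0)) -> same_germ x u v ->
  same_germ x (D u) (D v).
Proof. by move=> [_ lD] uv; exact: (local_cochain_germ (f := fun=> u) (g := fun=> v) lD). Qed.

Lemma CH2_germ (B : A -> A -> A) x u u' v v' :
  CH 2 (cochain2 B) -> same_germ x u u' -> same_germ x v v' ->
  same_germ x (B u v) (B u' v').
Proof.
move=> [_ lB] uu' vv'.
apply: (local_cochain_germ (f := fun i => if i == ord0 then u else v)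
  (g := fun i => if i == ord0 then u' else v') lB) => i.
by case: ifP.
Qed.

End Germs.

(** * A star-product is determined by its coefficients *)

Section StarExpansion.
Variables (R : realType) (d : nat) (M : smooth_manifold R d).
Variables (P : poisson_structure M) (s : star_product P).
Local Notation A := (smoothfun M).
Implicit Types (a b c : A) (f g h : fps M).

Lemma fps_split f :
  f = fps_add (fps_scale 1 (fps_const (f 0%N))) (fps_hbar (fun k => f k.+1)).
Proof.
by apply/funext => -[|k]; rewrite /fps_add /fps_scale /= ?scaler0 ?add0r ?addr0 ?scale1r.
Qed.

(** Peeling off constant terms, f = f_0 + hbar f', gives the coefficient of
    hbar^k by induction on k; hbar-linearity suffices, without an appeal to
    adic continuity. *)
Lemma starEl f g k :
  s f g k = \sum_(i < k.+1) s (fps_const (f i)) g (k - i)%N.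
Proof.
elim: k f => [|k IH] f; rewrite {1}[f]fps_split star_linearl star_hbarl.
  by rewrite big_ord1 /fps_add /fps_scale /= scale1r addr0.
by rewrite big_ord_recl /fps_add /fps_scale /= scale1r IH.
Qed.

Lemma starEr f g k :
  s f g k = \sum_(j < k.+1) s f (fps_const (g j)) (k - j)%N.
Proof.
elim: k g => [|k IH] g; rewrite {1}[g]fps_split star_linearr star_hbarr.
  by rewrite big_ord1 /fps_add /fps_scale /= scale1r addr0.
by rewrite big_ord_recl /fps_add /fps_scale /= scale1r IH.
Qed.

Lemma starE f g k : s f g k =
  \sum_(i < k.+1) \sum_(j < (k - i).+1) coef2 s (k - i - j) (f i) (g j).
Proof. by rewrite starEl; apply: eq_bigr => i _; rewrite starEr. Qed.

Lemma fps_const_linear (c : R) a b : fps_const (c *: a + b) =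
  fps_add (fps_scale c (fps_const a)) (fps_const b).
Proof.
by apply/funext => -[|k] //; rewrite /fps_add /fps_scale /= scaler0 addr0.
Qed.

Lemma coef2_linearl k (c : R) a a' b :
  coef2 s k (c *: a + a') b = c *: coef2 s k a b + coef2 s k a' b.
Proof. by rewrite /coef2 fps_const_linear star_linearl. Qed.

Lemma coef2_linearr k (c : R) a b b' :
  coef2 s k a (c *: b + b') = c *: coef2 s k a b + coef2 s k a b'.
Proof. by rewrite /coef2 fps_const_linear star_linearr. Qed.

Lemma coef20l k b : coef2 s k 0 b = 0.
Proof.
have := coef2_linearl k 1 0 0 b; rewrite !scale1r addr0.
by move/(congr1 (+%R^~ (- coef2 s k 0 b))); rewrite addrK subrr.
Qed.

Lemma coef20r k a : coef2 s k a 0 = 0.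
Proof.
have := coef2_linearr k 1 a 0 0; rewrite !scale1r addr0.
by move/(congr1 (+%R^~ (- coef2 s k a 0))); rewrite addrK subrr.
Qed.

Lemma coef2Nl k a b : coef2 s k (- a) b = - coef2 s k a b.
Proof. by rewrite -[- a]addr0 -scaleN1r coef2_linearl coef20l addr0 scaleN1r. Qed.

Lemma coef2Nr k a b : coef2 s k a (- b) = - coef2 s k a b.
Proof. by rewrite -[- b]addr0 -scaleN1r coef2_linearr coef20r addr0 scaleN1r. Qed.

Lemma coef2_germ x k a a' b b' : same_germ x a a' -> same_germ x b b' ->
  same_germ x (coef2 s k a b) (coef2 s k a' b').
Proof.
case: k => [|k]; first by rewrite !star_coef0; exact: same_germM.
exact/CH2_germ/star_coef_local.
Qed.

Lemma star_germ x f f' g g' :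
  (forall k, same_germ x (f k) (f' k)) -> (forall k, same_germ x (g k) (g' k)) ->
  forall k, same_germ x (s f g k) (s f' g' k).
Proof.
move=> ff' gg' k; rewrite !starE.
by apply: same_germ_sum => i; apply: same_germ_sum => j; exact: coef2_germ.
Qed.

Lemma coef2_assoc k a b c :
  \sum_(i < k.+1) coef2 s (k - i) (coef2 s i a b) c =
  \sum_(i < k.+1) coef2 s (k - i) a (coef2 s i b c).
Proof. by rewrite -[LHS]starEl -[RHS]starEr starA. Qed.

End StarExpansion.

(** * Formal differential operators are unitriangular *)

Section FormalDiffop.
Variables (R : realType) (d : nat) (M : smooth_manifold R d).
Local Notation A := (smoothfun M).
Variables (D : nat -> A -> A) (D_diffop : formal_diffop D).
Implicit Types (f g h : fps M).

Let D0 a : D 0 a = a. Proof. by case: D_diffop => ->. Qed.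
Let DCH k : CH 1 (fun f : 'I_1 -> A => D k.+1 (f ord0)).
Proof. by case: D_diffop => _; exact. Qed.

Lemma diffop_linear k (c : R) u v : D k (c *: u + v) = c *: D k u + D k v.
Proof. by case: k => [|k]; [rewrite !D0|exact: (CH1_linear _ _ _ (DCH k))]. Qed.

Lemma diffop0 k : D k 0 = 0.
Proof. by case: k => [|k]; [rewrite D0|exact: CH1_0 (DCH k)]. Qed.

Lemma apply_fpsE f k :
  apply_fps D f k = f k + \sum_(i < k) D i.+1 (f (k - i.+1)%N).
Proof. by rewrite /apply_fps big_ord_recl D0 subn0. Qed.

Lemma apply_fps_linear (c : R) f g : apply_fps D (fps_add (fps_scale c f) g) =
  fps_add (fps_scale c (apply_fps D f)) (apply_fps D g).
Proof.
apply/funext => k; rewrite /apply_fps /fps_add /fps_scale scaler_sumr -big_split.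
by apply: eq_bigr => i _; exact: diffop_linear.
Qed.

Lemma apply_fps_hbar f : apply_fps D (fps_hbar f) = fps_hbar (apply_fps D f).
Proof.
apply/funext => -[|k]; first by rewrite /apply_fps big_ord1 /= diffop0.
rewrite /apply_fps big_ord_recr subnn /= diffop0 addr0.
by apply: eq_bigr => i _; rewrite subSn// -ltnS.
Qed.

Lemma apply_fps_const a : apply_fps D (fps_const a) = D^~ a.
Proof.
apply/funext => k; rewrite /apply_fps big_ord_recr subnn /= big1 ?add0r // => i _.
by rewrite -[(k - i)%N]prednK ?subn_gt0 //= diffop0.
Qed.

Lemma apply_fps_eqmod N f g :
  fps_eqmod N f g -> fps_eqmod N (apply_fps D f) (apply_fps D g).
Proof.
move=> fg k kN; apply: eq_bigr => i _.
by rewrite fg // (leq_ltn_trans (leq_subr _ _)).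
Qed.

(** The coefficient f_k is the k-th coefficient of D f minus terms that depend
    on f_0, ..., f_(k-1) only, so it can be recovered inductively. *)
Lemma apply_fps_eqmod_inv N f g :
  fps_eqmod N (apply_fps D f) (apply_fps D g) -> fps_eqmod N f g.
Proof.
move=> DfDg; elim/ltn_ind => k IH kN.
have := DfDg k kN; rewrite !apply_fpsE.
rewrite [X in _ = _ + X](eq_bigr (fun i : 'I_k => D i.+1 (f (k - i.+1)%N))).
  by move/addIr.
move=> i _; have lk : (k - i.+1 < k)%N by rewrite ltn_subrL (leq_ltn_trans _ (ltn_ord i)).
by rewrite IH // (ltn_trans lk).
Qed.

Lemma apply_fps_inj : injective (apply_fps D).
Proof.
move=> f g DfDg; apply/funext => k; apply: (@apply_fps_eqmod_inv k.+1) => //.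
by rewrite DfDg.
Qed.

Lemma apply_fps_germ x f g : (forall k, same_germ x (f k) (g k)) ->
  forall k, same_germ x (apply_fps D f k) (apply_fps D g k).
Proof.
move=> fg k; rewrite !apply_fpsE; apply: same_germD => //.
by apply: same_germ_sum => i; exact: CH1_germ.
Qed.

(** The same recursion as in [apply_fps_eqmod_inv], with equality of germs at
    a point in place of equality. This replaces a proof that the inverse of D
    is local. *)
Lemma apply_fps_germ_inv x f g :
  (forall k, same_germ x (apply_fps D f k) (apply_fps D g k)) ->
  forall k, same_germ x (f k) (g k).
Proof.
move=> DfDg; elim/ltn_ind => k IH.
have fE h : h k = apply_fps D h k - \sum_(i < k) D i.+1 (h (k - i.+1)%N).
  by rewrite apply_fpsE addrK.
rewrite (fE f) (fE g); apply: same_germD => //; apply/same_germN/same_germ_sum => i.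
by apply: CH1_germ => //; apply: IH; rewrite ltn_subrL (leq_ltn_trans _ (ltn_ord i)).
Qed.

(** D g = f if and only if g is a fixed point of [fps_solve_step f]. *)
Definition fps_solve_step f g : fps M :=
  fun k => f k - \sum_(i < k) D i.+1 (g (k - i.+1)%N).

(** Each step of the iteration fixes one more coefficient, so that k+1 steps
    from an arbitrary start determine the coefficient of hbar^k. *)
Definition apply_fps_inv f : fps M :=
  fun k => iter k.+1 (fps_solve_step f) (fun=> 0) k.

Lemma apply_fpsK f : apply_fps D (apply_fps_inv f) = f.
Proof.
have step_contract N g h : fps_eqmod N g h ->
    fps_eqmod N.+1 (fps_solve_step f g) (fps_solve_step f h).
  move=> gh k kN; congr (_ - _); apply: eq_bigr => i _.
  by rewrite gh // (leq_trans _ (kN : (k <= N)%N)) // ltn_subrL (leq_ltn_trans _ (ltn_ord i)).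
pose g N := iter N (fps_solve_step f) (fun=> 0).
have stable N K : fps_eqmod N (g N) (g (N + K)%N).
  by elim: N => [//|N IH]; rewrite addSn; exact: step_contract.
have invE N : fps_eqmod N (apply_fps_inv f) (g N).
  by move=> k kN; rewrite -(subnKC kN) -stable.
apply/funext => k; rewrite apply_fpsE.
have /(_ k) -> // : fps_eqmod k.+1 (apply_fps_inv f) (fps_solve_step f (apply_fps_inv f)).
  move=> j jk; rewrite (invE k.+1) //; symmetry.
  exact: (step_contract _ _ _ (invE k)).
by rewrite /fps_solve_step subrK.
Qed.

End FormalDiffop.

(** * Conjugating a star-product by a formal differential operator *)

Section Conjugation.
Variables (R : realType) (d : nat) (M : smooth_manifold R d).
Variables (P : poisson_structure M) (s : star_product P).
Local Notation A := (smoothfun M).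
Variables (D : nat -> A -> A) (D_diffop : formal_diffop D).
Implicit Types (a b : A) (f g h : fps M).

Definition conj_star f g : fps M :=
  apply_fps_inv D (s (apply_fps D f) (apply_fps D g)).

Lemma apply_conj_star f g :
  apply_fps D (conj_star f g) = s (apply_fps D f) (apply_fps D g).
Proof. exact: apply_fpsK. Qed.

Let inj := apply_fps_inj D_diffop.

Lemma conj_star_linearl (c : R) f f' g :
  conj_star (fps_add (fps_scale c f) f') g =
  fps_add (fps_scale c (conj_star f g)) (conj_star f' g).
Proof.
by apply: inj; rewrite apply_fps_linear // !apply_conj_star apply_fps_linear // star_linearl.
Qed.

Lemma conj_star_linearr (c : R) f g g' :
  conj_star f (fps_add (fps_scale c g) g') =
  fps_add (fps_scale c (conj_star f g)) (conj_star f g').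
Proof.
by apply: inj; rewrite apply_fps_linear // !apply_conj_star apply_fps_linear // star_linearr.
Qed.

Lemma conj_star_hbarl f g : conj_star (fps_hbar f) g = fps_hbar (conj_star f g).
Proof.
by apply: inj; rewrite apply_fps_hbar // !apply_conj_star apply_fps_hbar // star_hbarl.
Qed.

Lemma conj_star_hbarr f g : conj_star f (fps_hbar g) = fps_hbar (conj_star f g).
Proof.
by apply: inj; rewrite apply_fps_hbar // !apply_conj_star apply_fps_hbar // star_hbarr.
Qed.

Lemma conj_star_adic_continuous f g N : exists K, forall f' g',
  fps_eqmod K f f' -> fps_eqmod K g g' ->
  fps_eqmod N (conj_star f g) (conj_star f' g').
Proof.
have [K sK] := star_adic_continuous s (apply_fps D f) (apply_fps D g) N.
exists K => f' g' ff' gg'; apply: (apply_fps_eqmod_inv D_diffop).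
by rewrite !apply_conj_star; apply: sK; exact: apply_fps_eqmod.
Qed.

(** Both sides are mapped by the injective operator D to the same triple
    product; the other axioms are transported in this way too. *)
Lemma conj_starA : associative conj_star.
Proof. by move=> f g h; apply: inj; rewrite !apply_conj_star starA. Qed.

Lemma conj_star_germ x f f' g g' :
  (forall k, same_germ x (f k) (f' k)) -> (forall k, same_germ x (g k) (g' k)) ->
  forall k, same_germ x (conj_star f g k) (conj_star f' g' k).
Proof.
move=> ff' gg'; apply: (apply_fps_germ_inv D_diffop) => k; rewrite !apply_conj_star.
by apply: star_germ => {}k; exact: apply_fps_germ.
Qed.

Lemma conj_star_coef_local k : CH 2 (cochain2 (coef2 conj_star k)).
Proof.
split=> [i f c u v|x f g fg].
  rewrite /cochain2 /coef2 /=; case: (unliftP ord0 i) => [j ->|->] /=.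
    rewrite ord1 /=.
    by rewrite fps_const_linear conj_star_linearr.
  by rewrite fps_const_linear conj_star_linearl.
have const_germ i j : same_germ x (fps_const (f i) j) (fps_const (g i) j).
  by case: j => [|j]; [exact: fg|exact: same_germ_refl].
exact: (nbhs_singleton (conj_star_germ (const_germ ord0) (const_germ ord_max) k)).
Qed.

Variables (m : nat) (m_ge2 : (2 <= m)%N)
  (D_sparse : forall i, (0 < i < m)%N -> D i = fun=> 0).

(** Comparison of the coefficients of hbar^k in D (a *' b) = D a * D b. A term
    B_l (D_i a, D_j b) with i, j > 0 has i, j >= m or is zero, hence degree at
    least 2 m, so below that degree only terms linear in the D_i remain. *)
Lemma conj_coef2 k a b : (k < m.*2)%N ->
  coef2 conj_star k a b = coef2 s k a b + \sum_(i < k)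
    (coef2 s (k - i.+1) (D i.+1 a) b + coef2 s (k - i.+1) a (D i.+1 b)
     - D i.+1 (coef2 conj_star (k - i.+1) a b)).
Proof.
move=> k2m; rewrite big_split sumrN addrA; apply: (canRL (addrK _)).
rewrite -[LHS](apply_fpsE D_diffop) apply_conj_star !apply_fps_const //.
have D0 c : D 0 c = c by case: D_diffop => ->.
rewrite starE big_ord_recl big_ord_recl !D0 !subn0 big_split /= -!addrA.
congr (_ + _); rewrite addrC; congr (_ + _).
apply: eq_bigr => i _; rewrite /bump /= add1n big_ord_recl D0 subn0.
have [im|mi] := ltnP i.+1 m.
  by rewrite D_sparse //= !coef20l add0r big1 // => j _; rewrite coef20l.
rewrite big1 ?addr0 // => j _; rewrite (D_sparse (i := bump 0 j)) ?coef20r //= /bump /=.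
have := ltn_ord j; move: k2m; rewrite -addnn; lia.
Qed.

Lemma conj_star_coef0 a b : coef2 conj_star 0 a b = a * b.
Proof. by rewrite conj_coef2 ?big_ord0 ?addr0 ?star_coef0 // -addnn; lia. Qed.

Lemma conj_coef2_low k a b : (k < m)%N -> coef2 conj_star k a b = coef2 s k a b.
Proof.
move=> km; rewrite conj_coef2 ?big1 ?addr0 //; last by rewrite -addnn; lia.
move=> i _; rewrite D_sparse /=; last by have := ltn_ord i; lia.
by rewrite coef20l coef20r subr0 addr0.
Qed.

Lemma conj_star_coef1 a b : coef2 conj_star 1 a b = bracket P a b.
Proof. by rewrite conj_coef2_low ?star_coef1. Qed.

(** The correction is the Hochschild differential of D_m. *)
Lemma conj_coef2_m a b : coef2 conj_star m a b =
  coef2 s m a b + (D m a * b + a * D m b - D m (a * b)).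
Proof.
rewrite conj_coef2; last by rewrite -addnn; lia.
case: m m_ge2 D_sparse => // l _ Ds; rewrite big_ord_recr big1 /= => [|i _].
  by rewrite add0r subnn !star_coef0 conj_star_coef0.
by rewrite Ds /= ?coef20l ?coef20r ?subr0 ?addr0 // ltnS.
Qed.

(** Besides the Hochschild differential of D_(m+1), the correction contains the
    derivative of the bracket along D_m, through the coefficient of degree 1:
    this is where the action of pi on 1-cocycles comes from. *)
Lemma conj_coef2_mS a b : coef2 conj_star m.+1 a b = coef2 s m.+1 a b
  + (bracket P (D m a) b + bracket P a (D m b) - D m (bracket P a b))
  + (D m.+1 a * b + a * D m.+1 b - D m.+1 (a * b)).
Proof.
rewrite conj_coef2; last by rewrite -addnn; lia.
rewrite -addrA; congr (_ + _).
case: m m_ge2 D_sparse conj_star_coef1 => // l _ Ds c1.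
rewrite big_ord_recr big_ord_recr big1 /= => [|i _].
  by rewrite add0r subnn subSn // subnn !star_coef0 !star_coef1 conj_star_coef0 c1.
by rewrite Ds /= ?coef20l ?coef20r ?subr0 ?addr0 // ltnS.
Qed.

Definition conj_star_product : star_product P :=
  StarProduct conj_star_linearl conj_star_linearr conj_star_hbarl
    conj_star_hbarr conj_star_adic_continuous conj_starA conj_star_coef0
    conj_star_coef1 (fun k _ => conj_star_coef_local k).

Lemma conj_star_equiv : star_equiv s conj_star_product.
Proof. by exists D => // f g; exact: apply_conj_star. Qed.

End Conjugation.

(** * Hochschild cochains of low degree *)

Section Hochschild.
Variables (R : realType) (d : nat) (M : smooth_manifold R d).
Variables (C : subalgebra M).
Local Notation A := (smoothfun M).

Lemma hochschild_d1 (phi : ('I_1 -> C) -> A) (f : 'I_2 -> C) :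
  hochschild_d phi f = set_val (f ord0) * phi (fun=> f ord_max)
    - phi (fun=> subalg_mul (f ord0) (f ord_max))
    + phi (fun=> f ord0) * set_val (f ord_max).
Proof.
rewrite /hochschild_d big_ord1 expr1 mulN1r sqrrN expr1n mul1r.
congr (_ * phi _ - phi _ + phi _ * _); apply/funext => i; rewrite ?(ord1 i).
- by congr f; apply/val_inj.
- rewrite /merge_args /=; congr subalg_mul; congr f; exact/val_inj.
- by congr f; apply/val_inj.
Qed.

Lemma hochschild_d2 (B : A -> A -> A) (f : 'I_3 -> C) :
  let a := set_val (f ord0) in let b := set_val (f (lift ord0 ord0)) in
  let c := set_val (f ord_max) in
  hochschild_d (restrict_cochain C (cochain2 B)) f =
    a * B b c - B (a * b) c + B a (b * c) - B a b * c.
Proof.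
rewrite /hochschild_d big_ord_recl big_ord1 /restrict_cochain /cochain2 /merge_args /=.
rewrite expr1 mulN1r sqrrN expr1n mul1r (exprS _ 2) sqrrN expr1n mulr1 mulN1r addrA.
have -> : lift ord0 ord_max = ord_max :> 'I_3 by exact/val_inj.
have -> : widen_ord (leqnSn 2) ord0 = ord0 by exact/val_inj.
by have -> : widen_ord (leqnSn 2) ord_max = lift ord0 ord0 by exact/val_inj.
Qed.

Lemma CHsub1P (phi : ('I_1 -> C) -> A) : CHsub C 1 phi -> exists2 D : A -> A,
  CH 1 (fun f : 'I_1 -> A => D (f ord0)) &
  forall a : C, phi (fun=> a) = D (set_val a).
Proof.
case=> psi psiCH <-; exists (fun u => psi (fun=> u)) => //.
rewrite (_ : (fun f => _) = psi) //; apply/funext => f; congr psi.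
by apply/funext => i; rewrite (ord1 i).
Qed.

Lemma CH_0 n : CH n (0 : ('I_n -> A) -> A).
Proof. by split=> // i f a u v; rewrite /GRing.zero /= scaler0 addr0. Qed.

Lemma CH_opp n (phi : ('I_n -> A) -> A) : CH n phi -> CH n (- phi).
Proof.
case=> mphi lphi; split=> [i f a u v|x f g fg].
  by rewrite /GRing.opp /= mphi opprD scalerN.
by congr (- _); exact: lphi.
Qed.

Lemma CHsub_0 n : CHsub C n 0.
Proof. by exists 0 => //; exact: CH_0. Qed.

Lemma hclass_refl n (phi : ('I_n.+1 -> C) -> A) : cocycle C n.+1 phi ->
  hclass phi phi.
Proof.
move=> cphi; split => //; rewrite subrr; exists 0; first exact: CHsub_0.
apply/funext => f; rewrite /hochschild_d mulr0 mul0r mulr0 addr0 add0r.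
by rewrite big1 // => j _; rewrite mulr0.
Qed.

End Hochschild.

(** * The obstruction cocycle and its removal *)

Section Obstruction.
Variables (R : realType) (d : nat) (M : smooth_manifold R d).
Variables (P : poisson_structure M) (C : subalgebra M) (s : star_product P).
Variables (n : nat) (s_vanishes : vanishes_upto C s n).
Local Notation A := (smoothfun M).
Let B := restrict_cochain C (cochain2 (coef2 s n.+1)).

Lemma first_coef_cocycle : cocycle C 2 B.
Proof.
split; first by exists (cochain2 (coef2 s n.+1)) => //; exact: star_coef_local.
apply/funext => f; rewrite hochschild_d2 /=.
set a := set_val (f ord0); set b := set_val (f (lift ord0 ord0)).
set c := set_val (f ord_max).
have Ca : subalg_set C a := set_valP _.
have Cb : subalg_set C b := set_valP _.
have Cc : subalg_set C c := set_valP _.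
(* Only the first and the last summand on each side of the associativity
   relation survive on C. *)
have := coef2_assoc s n.+1 a b c.
rewrite !(big_ord_recl n.+1) !(big_ord_recr n) !big1 /=; first last.
- by move=> i _; rewrite (s_vanishes (k := bump 0 i)) ?coef20l //= /bump /=; have := ltn_ord i; lia.
- by move=> i _; rewrite (s_vanishes (k := bump 0 i)) ?coef20r //= /bump /=; have := ltn_ord i; lia.
rewrite !add0r !subn0 /bump !add1n !subnn !star_coef0.
move/eqP; rewrite eq_sym -subr_eq0 => /eqP assoc; apply: etrans assoc.
by rewrite opprD addrA; congr (_ - _); rewrite addrAC [X in X - _]addrC.
Qed.

End Obstruction.

Definition two_term_diffop (T : zmodType) (n : nat) (X Y : T -> T) (k : nat) : T -> T :=
  if k == 0%N then id
  else if k == n then X else if k == n.+1 then Y else fun=> 0.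

Theorem lemma2 (R : realType) (d : nat) (M : smooth_manifold R d)
    (P : poisson_structure M) (C : subalgebra M)
    (C_commutative : forall f g : smoothfun M,
       subalg_set C f -> subalg_set C g -> bracket P f g = 0)
    (star : star_product P) (n : nat) (n_ge2 : (2 <= n)%N)
    (star_n : star_product P) (star_n_equiv : star_equiv star star_n)
    (star_n_vanishes : vanishes_upto C star_n n) :
  let B := restrict_cochain C (cochain2 (coef2 star_n n.+1)) in
  cocycle C 2 B /\
  ((pi_action_H P @` HH C 1) (hclass B) ->
   exists2 star_n1 : star_product P,
     star_equiv star_n star_n1 & vanishes_upto C star_n1 n.+1).
Proof.
move=> B; have Bcocycle : cocycle C 2 B := first_coef_cocycle star_n_vanishes.
split=> // -[X0 [xi0 _ X0E] piX].
(* As B represents its own class, it is cohomologous to [pi, xi] for some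
   cocycle xi representing the given class in degree 1. *)
have : hclass B B := hclass_refl Bcocycle.
rewrite -piX -X0E => -[xi [[xiCH dxi] _] [_ [eta etaCH deta]]].
have [X XCH xiE] := CHsub1P xiCH; have [Y YCH etaE] := CHsub1P etaCH.
pose D := two_term_diffop n (fun u => - X u) (fun u => - Y u).
have D_diffop : formal_diffop D.
  split=> // -[//|k] _; rewrite /D /two_term_diffop /=.
  case: eqP => _; first exact: (CH_opp XCH).
  by case: eqP => _; [exact: (CH_opp YCH)|exact: CH_0].
have D_sparse i : (0 < i < n)%N -> D i = fun=> 0.
  by move=> /andP[i0 i_n]; rewrite /D /two_term_diffop gtn_eqF // !ltn_eqF // ltnW.
have Dn u : D n u = - X u.
  by rewrite /D /two_term_diffop gtn_eqF ?eqxx // ltnW.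
have DSn u : D n.+1 u = - Y u.
  by rewrite /D /two_term_diffop /= gtn_eqF ?eqxx.
exists (conj_star_product star_n D_diffop n_ge2 D_sparse).
  exact: conj_star_equiv.
move=> k k_n a b Ca Cb /=.
pose aC : C := SigSub (mem_set Ca); pose bC : C := SigSub (mem_set Cb).
(* The pair (a, b) at which the cochain identities are evaluated. *)
pose ab (i : 'I_2) := if i == ord0 then aC else bC.
have dX : a * X b - X (a * b) + X a * b = 0.
  by have := congr1 (fun F => F ab) dxi; rewrite hochschild_d1 !xiE.
have dY : a * Y b - Y (a * b) + Y a * b =
    coef2 star_n n.+1 a b - (bracket P (X a) b + bracket P a (X b)).
  have := congr1 (fun F => F ab) deta; rewrite hochschild_d1 !etaE => ->.
  by rewrite -(xiE aC) -(xiE bC).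
have [kn|nk|->] := ltngtP k n.
- by rewrite (conj_coef2_low _ D_diffop n_ge2 D_sparse) // star_n_vanishes // (ltnW kn) andbT; case/andP: k_n.
- have -> : k = n.+1 by apply/eqP; rewrite eqn_leq nk; case/andP: k_n => _ ->.
  rewrite (conj_coef2_mS _ D_diffop n_ge2 D_sparse) !Dn !DSn.
  rewrite (C_commutative a b Ca Cb) (CH1_0 XCH) !oppr0 addr0 -!(star_coef1 star_n).
  rewrite coef2Nl coef2Nr -opprD !star_coef1 mulNr mulrN opprK.
  have -> : - (Y a * b) - a * Y b + Y (a * b) = - (a * Y b - Y (a * b) + Y a * b).
    by ring.
  by rewrite dY subrr.
- rewrite (conj_coef2_m _ D_diffop n_ge2 D_sparse) !Dn.
  rewrite star_n_vanishes ?(leqnn n, ltnW n_ge2) //.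
  rewrite add0r mulNr mulrN opprK -[RHS]oppr0 -dX. ring.
Qed.
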